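(* For every constant $c > 0$ there exists a constant $K = K(c) > 0$ such that for all positive integers $k$ and $\ell$ with $\ell \le \binom{k}{2}$ and $\min\{\ell,\, k^2/2 - \ell\} \ge c k^2$ we have $$\mathrm{ind}(k,\ell) \le K k^{-0.1}.$$
   Context: All graphs are finite and simple. For a positive integer $k$ and a graph $G$ with at least $k$ vertices, let $A = A_{G,k}$ be chosen uniformly at random from all $k$-element subsets of $V(G)$, and let $X_{G,k} = e(G[A])$ be the number of edges of $G$ with both endpoints in $A$. For integers $n \ge k$ and $0 \le \ell \le \binom{k}{2}$ let $I(n,k,\ell) = \max\{\mathbb{P}(X_{G,k} = \ell) : G \text{ is a graph on } n \text{ vertices}\}$. For fixed $k,\ell$ the sequence $I(n,k,\ell)$ is non-increasing in $n$, and the edge-inducibility is defined by $\mathrm{ind}(k,\ell) := \lim_{n\to\infty} I(n,k,\ell)$. *)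

(* Defs.v *)
From HB Require Import structures.
From mathcomp Require Import all_boot all_order all_algebra.
From mathcomp Require Import all_classical all_reals all_analysis.
Set Implicit Arguments.
Unset Strict Implicit.
Unset Printing Implicit Defensive.
Import Order.TTheory GRing.Theory Num.Theory.
Import numFieldNormedType.Exports.
Local Open Scope ring_scope.

(* A finite simple graph on the vertex type T is given by its edge set, a set
   of two-element subsets of T. *)
Definition simple_graph (T : finType) (E : {set {set T}}) : bool :=
  [forall e in E, #|e| == 2%N].

Definition induced_edges (T : finType) (E : {set {set T}}) (A : {set T}) : nat :=
  #|[set e in E | e \subset A]|.

Definition ksubsets (T : finType) (k : nat) : {set {set T}} :=
  [set A : {set T} | #|A| == k].

(* P(X_{G,k} = l) for A uniform on the k-subsets of the vertex set.  When
   k > #|T| there are no k-subsets and the value is 0 / 0 = 0. *)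
Definition edge_count_prob (R : realType) (T : finType) (E : {set {set T}})
    (k l : nat) : R :=
  #|[set A in ksubsets T k | induced_edges E A == l]|%:R / #|ksubsets T k|%:R.

(* I(n, k, l).  The default 0 is harmless, as the maximum is over a nonempty
   family of nonnegative reals. *)
Definition max_edge_prob (R : realType) (n k l : nat) : R :=
  \big[Num.max/0]_(E : {set {set 'I_n}} | simple_graph E)
    edge_count_prob R E k l.

(* The finitely many values at n < k do not affect the limit. *)
Definition edge_inducibility (R : realType) (k l : nat) : R :=
  limn (fun n => max_edge_prob R n k l).

(* Main.v *)
Require Import Defs.
From HB Require Import structures.
From mathcomp Require Import all_boot all_order all_algebra.
From mathcomp Require Import all_classical all_reals all_analysis.
From mathcomp Require Import ring lra zify.
Import Order.TTheory GRing.Theory Num.Theory.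
Import numFieldNormedType.Exports.
Local Open Scope ring_scope.
Set Implicit Arguments.
Unset Strict Implicit.
Unset Printing Implicit Defensive.

(* For n >= 2 k^2 a uniform k-subset may be replaced, at the cost of a factor
   2, by k independent uniform vertices.  The edge count then has variance at
   most k^3, so Chebyshev's inequality settles the case where the edge density
   d is not bounded away from 0 and 1.  Otherwise split the k vertices into two
   halves Y and Z: two applications of Cauchy-Schwarz bound the fourth power of
   the probability by P(e(Y,Z) - e(Y',Z) - e(Y,Z') + e(Y',Z') = 0) with
   independent copies Y', Z'.  Given Y, Y' this is a sum of independent
   differences h(z) - h(z'), where h(z) is in turn such a sum over Y, Y'; since
   e(y,z) - e(y,z') - e(y',z) + e(y',z') is nonzero with probability at least
   d^2 (1 - d)^2 / 7, applying a Littlewood-Offord bound twice gives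
   O(k^(-1/2)), that is O(k^(-1/8)) for the original probability. *)

(** * Averages over finite types *)

Definition avg (R : realFieldType) (T : finType) (F : T -> R) : R :=
  (\sum_x F x) / #|T|%:R.

Notation "\avg_ ( x : T ) F" := (avg (fun x : T => F))
  (at level 41, F at level 41, x, T at level 50,
   format "'[' \avg_ ( x  :  T ) '/  '  F ']'") : ring_scope.

Lemma eq_avg (R : realFieldType) (T : finType) (F G : T -> R) :
  F =1 G -> avg F = avg G.
Proof. by move=> FG; congr (_ / _); apply: eq_bigr. Qed.

Lemma avg_cst (R : realFieldType) (T : finType) (a : R) :
  (0 < #|T|)%N -> \avg_(x : T) a = a.
Proof.
move=> T0; rewrite /avg sumr_const -[X in X / _]mulr_natr mulfK //.
by rewrite pnatr_eq0 -lt0n.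
Qed.

Lemma avgD (R : realFieldType) (T : finType) (F G : T -> R) :
  \avg_(x : T) (F x + G x) = avg F + avg G.
Proof. by rewrite /avg big_split /= mulrDl. Qed.

Lemma avgZl (R : realFieldType) (T : finType) (a : R) (F : T -> R) :
  \avg_(x : T) (a * F x) = a * avg F.
Proof. by rewrite /avg -mulr_sumr mulrA. Qed.

Lemma avgZr (R : realFieldType) (T : finType) (a : R) (F : T -> R) :
  \avg_(x : T) (F x * a) = avg F * a.
Proof. by rewrite /avg -mulr_suml mulrAC. Qed.

Lemma avgN (R : realFieldType) (T : finType) (F : T -> R) :
  \avg_(x : T) (- F x) = - avg F.
Proof. by rewrite /avg sumrN mulNr. Qed.

Lemma avgB (R : realFieldType) (T : finType) (F G : T -> R) :
  \avg_(x : T) (F x - G x) = avg F - avg G.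
Proof. by rewrite avgD avgN. Qed.

Lemma ler_avg (R : realFieldType) (T : finType) (F G : T -> R) :
  (forall x, F x <= G x) -> avg F <= avg G.
Proof. by move=> FG; rewrite ler_wpM2r ?invr_ge0 ?ler0n ?ler_sum. Qed.

Lemma avg_ge0 (R : realFieldType) (T : finType) (F : T -> R) :
  (forall x, 0 <= F x) -> 0 <= avg F.
Proof. by move=> F0; rewrite divr_ge0 ?ler0n ?sumr_ge0. Qed.

Lemma avg_le (R : realFieldType) (T : finType) (F : T -> R) (a : R) :
  (0 < #|T|)%N -> (forall x, F x <= a) -> avg F <= a.
Proof. by move=> T0 Fa; rewrite -[leRHS](avg_cst a T0); apply: ler_avg. Qed.

Lemma avg_ex_le (R : realFieldType) (T : finType) (F : T -> R) :
  (0 < #|T|)%N -> exists x, avg F <= F x.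
Proof.
move=> /[dup] T0 /card_gt0P[x0 _].
have [x _ xF] := @arg_maxP _ R T x0 xpredT F isT.
by exists x; apply: avg_le => // y; exact: xF.
Qed.

Lemma avg_sum (R : realFieldType) (T : finType) (I : Type) (r : seq I)
    (F : I -> T -> R) :
  \avg_(x : T) (\sum_(i <- r) F i x) = \sum_(i <- r) avg (F i).
Proof. by rewrite /avg exchange_big /= mulr_suml. Qed.

Lemma exchange_avg (R : realFieldType) (T U : finType) (F : T -> U -> R) :
  \avg_(x : T) \avg_(y : U) F x y = \avg_(y : U) \avg_(x : T) F x y.
Proof. by rewrite /avg -!mulr_suml exchange_big /= mulrAC. Qed.

Lemma avg_tuple0 (R : realFieldType) (T : finType) (F : seq T -> R) :
  \avg_(t : 0.-tuple T) F t = F [::].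
Proof.
rewrite -[RHS](@avg_cst _ {: 0.-tuple T}) ?card_tuple ?expn0 //.
by apply: eq_avg => t; rewrite tuple0.
Qed.

(** This expresses independence of the entries of a uniform tuple. [F] lives on sequences so that
    one function serves tuples of every length in inductions. *)
Lemma avg_tupleS (R : realFieldType) (T : finType) (m : nat) (F : seq T -> R) :
  \avg_(t : m.+1.-tuple T) F t =
  \avg_(x : T) \avg_(t : m.-tuple T) F (x :: t).
Proof.
rewrite /avg -mulr_suml -mulrA; congr (_ * _); last first.
  by rewrite !card_tuple expnSr natrM invfM.
rewrite pair_big /= (reindex (fun p : T * m.-tuple T => [tuple of p.1 :: p.2])).
  by [].
exists (fun t : m.+1.-tuple T => (thead t, [tuple of behead t])).
  by move=> [x t] _; congr (_, _); apply: val_inj.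
by move=> t _; rewrite [in RHS](tuple_eta t).
Qed.

Lemma avg_tuple_cat (R : realFieldType) (T : finType) (a b : nat)
    (F : seq T -> R) :
  \avg_(t : (a + b).-tuple T) F t =
  \avg_(s : a.-tuple T) \avg_(t : b.-tuple T) F (s ++ t).
Proof.
elim: a F => [|a IH] F; first
  by rewrite (avg_tuple0 (fun s => \avg_(t : b.-tuple T) F (s ++ t))).
rewrite (avg_tupleS (a + b)).
rewrite (avg_tupleS a (fun s => \avg_(t : b.-tuple T) F (s ++ t))).
by apply: eq_avg => x; rewrite (IH (fun s => F (x :: s))).
Qed.

Lemma card_tuple_gt0 (T : finType) (m : nat) :
  (0 < #|T|)%N -> (0 < #|{: m.-tuple T}|)%N.
Proof. by move=> T0; rewrite card_tuple expn_gt0 T0. Qed.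

Lemma sqr_avg_le (R : realFieldType) (T : finType) (F : T -> R) :
  (0 < #|T|)%N -> avg F ^+ 2 <= \avg_(x : T) F x ^+ 2.
Proof.
move=> T0; rewrite -subr_ge0.
have -> : \avg_(x : T) F x ^+ 2 - avg F ^+ 2 = \avg_(x : T) (F x - avg F) ^+ 2.
  transitivity (\avg_(x : T) (F x ^+ 2 + (- 2 * avg F * F x + avg F ^+ 2))).
    by rewrite !avgD avgZl avg_cst //; ring.
  by apply: eq_avg => x; ring.
by apply: avg_ge0 => x; exact: sqr_ge0.
Qed.

Lemma avg_mul (R : realFieldType) (T : finType) (F G : T -> R) :
  avg F * avg G = \avg_(x : T) \avg_(y : T) (F x * G y).
Proof. by rewrite -avgZr; apply: eq_avg => x; rewrite avgZl. Qed.

(** * Littlewood-Offord *)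

(** The [m]-step law of a symmetric random walk with steps [h x - h y], written as a difference of
    two sums because decoupling produces it in this shape. *)
Definition diff_law (R : realFieldType) (T : finType) (h : T -> int)
    (m : nat) (z : int) : R :=
  \avg_(s : m.-tuple T) \avg_(t : m.-tuple T)
    (\sum_(x <- s) h x - \sum_(y <- t) h y == z)%:R.

(** For integer-valued [h], the probability that a step of this walk is nonzero. *)
Definition diff_prob (R : realFieldType) (T : finType) (A : eqType)
  (h : T -> A) : R := \avg_(x : T) \avg_(y : T) (h x != h y)%:R.

Lemma diff_lawS (R : realFieldType) (T : finType) (h : T -> int) m z :
  diff_law R h m.+1 z =
  \avg_(x : T) \avg_(y : T) diff_law R h m (z - (h x - h y)).
Proof.
rewrite /diff_law (avg_tupleS m (fun s => \avg_(t : m.+1.-tuple T)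
    (\sum_(x <- s) h x - \sum_(y <- t) h y == z)%:R)).
apply: eq_avg => x; rewrite [RHS]exchange_avg; apply: eq_avg => s.
rewrite (avg_tupleS m (fun t =>
    (\sum_(x <- x :: s) h x - \sum_(y <- t) h y == z)%:R)).
apply: eq_avg => y; apply: eq_avg => t; rewrite !big_cons.
by rewrite -subr_eq0 -[in RHS]subr_eq0; congr ((_ == _)%:R); ring.
Qed.

Lemma diff_law_sum_le1 (R : realFieldType) (T : finType) (h : T -> int) m
    (X : seq int) :
  (0 < #|T|)%N -> uniq X -> \sum_(z <- X) diff_law R h m z <= 1.
Proof.
move=> T0 uX; rewrite /diff_law -avg_sum; apply: avg_le => [|s].
  exact: card_tuple_gt0.
rewrite -avg_sum; apply: avg_le => [|t]; first exact: card_tuple_gt0.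
set v := \sum_(x <- s) _ - _ => /=.
have -> : \sum_(z <- X) (v == z)%:R = (count_mem v X)%:R :> R.
  rewrite -sum1_count natr_sum [RHS]big_mkcond /=; apply: eq_bigr => z _.
  by rewrite eq_sym; case: eqP.
by rewrite count_uniq_mem // lern1 leq_b1.
Qed.

(** The two translates have equal size but element sums differing by [2 w |X|], which is nonzero, so
    neither contains the other and an element can change sides. *)
Lemma translates_rebalance (X : seq int) (w : int) :
  uniq X -> X != [::] -> w != 0 ->
  exists Y : seq int * seq int,
    [/\ uniq Y.1, uniq Y.2, size Y.1 = (size X).+1, size Y.2 = (size X).-1 &
     perm_eq (Y.1 ++ Y.2) ([seq z - w | z <- X] ++ [seq z + w | z <- X])].
Proof.
move=> uX X0 w0; set A := [seq z - w | z <- X]; set B := [seq z + w | z <- X].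
have uA : uniq A by rewrite map_inj_uniq // => x y; exact: addIr.
have uB : uniq B by rewrite map_inj_uniq // => x y; exact: addIr.
have [/allP sAB | /allPn[y yA yB]] := boolP (all (mem B) A); last first.
  (* y is moved from X - w to X + w. *)
  exists (y :: B, rem y A); split; rewrite /= ?yB ?rem_uniq ?size_map //.
    by rewrite size_rem // size_map.
  rewrite perm_sym (perm_catl _ (perm_refl _)).
  rewrite (permPl (perm_cat (perm_to_rem yA) (perm_refl B))) /=.
  by rewrite perm_cons perm_catC.
have [|_ eAB] := uniq_min_size uA sAB; first by rewrite !size_map.
have pAB : perm_eq A B by apply: uniq_perm.
have : \sum_(z <- A) z = \sum_(z <- B) z by apply: perm_big.
rewrite /A /B !big_map !big_split /= !big_const_seq !count_predT !iter_addr.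
case: X X0 {A B uX uA uB sAB eAB pAB} => // x X _ /=.
move/addrI/addIr => e; have : (- w - w) *+ (size X).+1 == 0.
  by rewrite mulrnBl subr_eq0 e.
by rewrite mulrn_eq0 /=; lia.
Qed.

(* For the lazy walk that starts at r and moves with probability p, r / L is the
   probability of reaching L before 0 and r (L - r) / p the mean exit time from
   (0, L), so the right-hand side bounds the mean time spent before hitting 0;
   translates_rebalance makes the sizes of the sets perform this walk.  The
   sets X t vary with t so that the terms can be compared with a single law. *)
Lemma diff_law_sum_le (R : realFieldType) (T : finType) (h : T -> int)
    (m r L : nat) (X : nat -> seq int) :
  (0 < #|T|)%N -> 0 < diff_prob R h -> (0 < L)%N -> (r <= L)%N ->
  (forall t, uniq (X t)) -> (forall t, size (X t) = r) ->
  \sum_(0 <= t < m) \sum_(z <- X t) diff_law R h t z <=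
  m%:R * r%:R / L%:R + r%:R * (L%:R - r%:R) / diff_prob R h.
Proof.
move=> T0; set p := diff_prob R h => p0 L0; elim: m r X => [|m IH] r X rL uX sX.
  rewrite big_geq // !mul0r add0r divr_ge0 ?(ltW p0) // mulr_ge0 ?ler0n //.
  by rewrite subr_ge0 ler_nat.
have [r0|r0] := posnP r.
  rewrite big1 => [|t _]; first by rewrite r0 !(mul0r, mulr0) addr0.
  by have /size0nil -> := etrans (sX t) r0; rewrite big_nil.
(* At [r = L] the quadratic term vanishes and the bound reads [m.+1]: each time contributes at most
   1, the total mass. *)
have [rL'|rL'] := leqP L r.
  have -> : r = L by apply/eqP; rewrite eqn_leq rL.
  rewrite subrr mulr0 mul0r addr0 mulfK ?pnatr_eq0 -?lt0n //.
  have -> : m.+1%:R = \sum_(0 <= t < m.+1) 1 :> R.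
    by rewrite sumr_const_nat subn0.
  by apply: ler_sum => t _; apply: diff_law_sum_le1.
rewrite big_nat_recl //.
pose Phi (a : R) : R := m%:R * a / L%:R + a * (L%:R - a) / p.
pose G w := \sum_(0 <= t < m) \sum_(z <- X t.+1) diff_law R h t (z - w).
have -> : \sum_(0 <= t < m) \sum_(z <- X t.+1) diff_law R h t.+1 z =
    \avg_(x : T) \avg_(y : T) G (h x - h y).
  rewrite /G; under eq_bigr => t _ do under eq_bigr => z _ do rewrite diff_lawS.
  have avg2_sum I (v : seq I) (F : I -> T -> T -> R) :
      \avg_(x : T) \avg_(y : T) \sum_(i <- v) F i x y =
      \sum_(i <- v) \avg_(x : T) \avg_(y : T) F i x y.
    by rewrite -avg_sum; apply: eq_avg => x; rewrite avg_sum.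
  rewrite avg2_sum; apply: eq_bigr => t _; rewrite avg2_sum.
  by apply: eq_bigr => z _.
have LR : 0 < L%:R :> R by rewrite ltr0n.
(* For [w != 0] the translates by [w] and [- w] are traded for sets of sizes [r + 1] and [r - 1];
   the second difference of [Phi] is exactly [- 2 / p]. *)
have GN w : G w + G (- w) <= 2 * Phi r%:R - 2 / p * (w != 0)%:R.
  have [-> | w0] := eqVneq w 0; rewrite /= ?oppr0 ?mulr0 ?mulr1 ?subr0.
    suff : G 0 <= Phi r%:R by lra.
    rewrite /G; under eq_bigr => t _ do under eq_bigr => z _ do rewrite subr0.
    exact: (IH r (fun t => X t.+1)).
  have XN t : X t.+1 != [::] by rewrite -size_eq0 sX -lt0n.
  have [Y /all_and5[uY1 uY2 sY1 sY2 pY]] :=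
    choice (fun t => translates_rebalance (uX t.+1) (XN t) w0).
  have -> : G w + G (- w) =
      \sum_(0 <= t < m) \sum_(z <- (Y t).1) diff_law R h t z +
      \sum_(0 <= t < m) \sum_(z <- (Y t).2) diff_law R h t z.
    rewrite /G -!big_split /=; apply: eq_bigr => t _.
    rewrite -big_cat (perm_big _ (pY t)) big_cat !big_map /=.
    by congr (_ + _); apply: eq_bigr => z _; rewrite opprK.
  have Y1 := IH r.+1 (fun t => (Y t).1) rL' uY1.
  have Y2 := IH r.-1 (fun t => (Y t).2) (leq_trans (leq_pred r) rL) uY2.
  apply: le_trans (lerD (Y1 _) (Y2 _)) _ => [t|t|].
  - by rewrite sY1 sX.
  - by rewrite sY2 sX.
  rewrite -/p -/(Phi r.+1%:R) -/(Phi r.-1%:R).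
  have -> : r.-1%:R = r%:R - 1 :> R by rewrite -subn1 natrB.
  rewrite -natr1 /Phi le_eqVlt; apply/orP; left; apply/eqP; field.
  by rewrite !gt_eqF.
(* Steps are symmetric, so the mean of [G w] is half that of [G w + G (- w)]. A step is nonzero with
   probability [p], whence a gain of 1, which will pay for the term [t = 0]. *)
have Gavg : \avg_(x : T) \avg_(y : T) G (h x - h y) <= Phi r%:R - 1.
  have avg_sym : \avg_(x : T) \avg_(y : T) G (h x - h y) =
      \avg_(x : T) \avg_(y : T) G (- (h x - h y)).
    rewrite exchange_avg; apply: eq_avg => x; apply: eq_avg => y.
    by rewrite opprB.
  suff : \avg_(x : T) \avg_(y : T) (G (h x - h y) + G (- (h x - h y))) <=
      2 * Phi r%:R - 2 / p * p.
    under eq_avg => x do rewrite avgD.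
    by rewrite avgD -avg_sym divfK ?gt_eqF //; lra.
  have <- : \avg_(x : T) \avg_(y : T)
      (2 * Phi r%:R - 2 / p * (h x - h y != 0)%:R) = 2 * Phi r%:R - 2 / p * p.
    transitivity (\avg_(x : T)
      (2 * Phi r%:R - 2 / p * \avg_(y : T) (h x != h y)%:R)).
      apply: eq_avg => x; rewrite avgB avg_cst // avgZl; congr (_ - _ * _).
      by apply: eq_avg => y; rewrite subr_eq0.
    by rewrite avgB avg_cst // avgZl.
  by apply: ler_avg => x; apply: ler_avg => y.
apply: le_trans (lerD (diff_law_sum_le1 R h 0 T0 (uX 0%N)) Gavg) _.
rewrite addrC subrK /Phi lerD2r -!mulrA.
by rewrite ler_wpM2r ?divr_ge0 ?ler0n ?ler_nat.
Qed.

(** A later law is an average of translates of an earlier one, so the largest point mass cannot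
    grow. *)
Lemma diff_law_nonincr (R : realFieldType) (T : finType) (h : T -> int)
    (m t : nat) (z : int) :
  (0 < #|T|)%N -> (t <= m)%N ->
  exists z', diff_law R h m z <= diff_law R h t z'.
Proof.
move=> T0 /subnK <-; elim: (m - t)%N z => [|d IH] z; first by exists z.
rewrite addSn diff_lawS.
have [x xP] :=
  avg_ex_le (fun x => \avg_(y : T) diff_law R h (d + t) (z - (h x - h y))) T0.
have [y yP] := avg_ex_le (fun y => diff_law R h (d + t) (z - (h x - h y))) T0.
have [z' z'P] := IH (z - (h x - h y)).
by exists z'; exact: le_trans xP (le_trans yP z'P).
Qed.

(** By monotonicity the mass at time [m] is at most a time average of masses at suitable single
    points, to which [diff_law_sum_le] applies with [r = 1]. The choice of [L] near the square root
    of [p m], with [p] the nonzero-step probability, gives the usual Littlewood-Offord rate. *)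
Lemma diff_law_le (R : realFieldType) (T : finType) (h : T -> int)
    (m L : nat) (z : int) :
  (0 < #|T|)%N -> 0 < diff_prob R h -> (0 < L)%N -> (0 < m)%N ->
  diff_law R h m z <= L%:R^-1 + L%:R / (diff_prob R h * m%:R).
Proof.
move=> T0 p0 L0 m0.
have mR : 0 < m%:R :> R by rewrite ltr0n.
have LR : 0 < L%:R :> R by rewrite ltr0n.
have zP t : exists z', (t <= m)%N -> diff_law R h m z <= diff_law R h t z'.
  have [tm|] := leqP t m; last by exists 0.
  by have [z' ?] := diff_law_nonincr R h z T0 tm; exists z'.
have [x xP] := choice zP.
rewrite -(ler_pM2l mR); apply: (@le_trans _ _
  (\sum_(0 <= t < m) \sum_(y <- [:: x t]) diff_law R h t y)).
  rewrite -[X in X%:R]subn0 mulr_natl -sumr_const_nat !big_nat.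
  by apply: ler_sum => t /andP[_ /ltnW tm]; rewrite big_seq1 xP.
apply: le_trans
  (@diff_law_sum_le _ _ h m 1 L (fun t => [:: x t]) T0 p0 L0 _ _ _) _ => //.
rewrite mulr1 mul1r mulrDr lerD2l.
apply: (@le_trans _ _ (L%:R / diff_prob R h)).
  by rewrite ler_wpM2r ?invr_ge0 ?(ltW p0) // gerBl.
by rewrite le_eqVlt; apply/orP; left; apply/eqP; field; rewrite !gt_eqF.
Qed.

(** * Edge counts of random vertex sequences *)

(** Pairs of positions are counted, so repeated vertices are allowed, as independent sampling
    requires. *)
Fixpoint edges_in (T : Type) (e : rel T) (s : seq T) : nat :=
  if s is x :: s' then (\sum_(y <- s') e x y + edges_in e s')%N else 0.

Lemma edges_in_cat (T : Type) (e : rel T) (s t : seq T) :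
  edges_in e (s ++ t) =
  (edges_in e s + edges_in e t + \sum_(x <- s) \sum_(y <- t) e x y)%N.
Proof.
elim: s => [|x s IH] /=; first by rewrite big_nil addn0.
by rewrite IH big_cons big_cat /=; lia.
Qed.

(** Diagonal pairs are included, so [m] independent vertices have mean edge count exactly ['C(m, 2)]
    times the density. *)
Definition density (R : realFieldType) (T : finType) (e : rel T) : R :=
  \avg_(x : T) \avg_(y : T) (e x y)%:R.

Lemma avg_sqr_sum_le (R : realFieldType) (T : finType) (f : T -> R) (m : nat) :
  (0 < #|T|)%N -> avg f = 0 -> (forall x, f x ^+ 2 <= 1) ->
  \avg_(s : m.-tuple T) (\sum_(x <- s) f x) ^+ 2 <= m%:R.
Proof.
move=> T0 f0 f1; elim: m => [|m IH].
  by rewrite (avg_tuple0 (fun s => (\sum_(x <- s) f x) ^+ 2)) big_nil expr0n.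
rewrite (avg_tupleS m (fun s => (\sum_(x <- s) f x) ^+ 2)).
set S := \avg_(s : m.-tuple T) (\sum_(x <- s) f x) ^+ 2 in IH *.
have -> : \avg_(x : T) \avg_(s : m.-tuple T) (\sum_(y <- x :: s) f y) ^+ 2 =
    \avg_(x : T) f x ^+ 2 + S.
  transitivity (\avg_(x : T) (f x ^+ 2 +
      ((2 * \avg_(s : m.-tuple T) \sum_(y <- s) f y) * f x + S))).
    apply: eq_avg => x.
    transitivity (\avg_(s : m.-tuple T) (f x ^+ 2 +
        (2 * f x * (\sum_(y <- s) f y) + (\sum_(y <- s) f y) ^+ 2))).
      by apply: eq_avg => s; rewrite big_cons; ring.
    by rewrite !avgD avg_cst ?card_tuple_gt0 // avgZl -/S; ring.
  by rewrite !avgD avgZl f0 mulr0 add0r avg_cst.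
by rewrite -natr1 addrC lerD // avg_le.
Qed.

(** Induction adding one vertex [x]: the old deviation [A] gains [B x], whose mean over [x] is a sum
    of independent centred terms and hence has second moment at most [m]. *)
Lemma edges_in_variance (R : realFieldType) (T : finType) (e : rel T)
    (m : nat) :
  (0 < #|T|)%N ->
  \avg_(s : m.-tuple T)
    ((edges_in e s)%:R - 'C(m, 2)%:R * density R e) ^+ 2 <= m%:R ^+ 3.
Proof.
move=> T0; set d := density R e.
have d01 : 0 <= d <= 1.
  rewrite avg_ge0 => [|x]; last by apply: avg_ge0 => y; exact: ler0n.
  by apply: avg_le => // x; apply: avg_le => // y; rewrite lern1 leq_b1.
elim: m => [|m IH].
  rewrite (avg_tuple0 (fun s => ((edges_in e s)%:R - 'C(0, 2)%:R * d) ^+ 2)).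
  by rewrite mul0r subr0 !expr0n.
rewrite (avg_tupleS m
  (fun s => ((edges_in e s)%:R - 'C(m.+1, 2)%:R * d) ^+ 2)).
pose A (s : seq T) := (edges_in e s)%:R - 'C(m, 2)%:R * d.
pose B x (s : seq T) := \sum_(y <- s) ((e x y)%:R - d).
pose f y := \avg_(x : T) (e x y)%:R - d.
have m1 : 0 < m%:R + 1 :> R by rewrite natr1 ltr0n.
have f2 y : f y ^+ 2 <= 1.
  have : 0 <= \avg_(x : T) ((e x y)%:R : R) <= 1.
    rewrite avg_ge0 => [|x]; last exact: ler0n.
    by apply: avg_le => // x; rewrite lern1 leq_b1.
  by rewrite /f; move: (avg _) => v; nra.
have f0 : avg f = 0.
  by rewrite avgB avg_cst // exchange_avg subrr.
apply: (@le_trans _ _ (\avg_(s : m.-tuple T) ((1 + (m%:R + 1)^-1) * A s ^+ 2 +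
   ((m%:R + 1) * (\sum_(y <- s) f y) ^+ 2 + m%:R ^+ 2)))).
  rewrite exchange_avg; apply: ler_avg => s.
  have -> : \avg_(x : T)
        ((edges_in e (x :: s))%:R - 'C(m.+1, 2)%:R * d) ^+ 2 =
      A s ^+ 2 + 2 * A s * (\sum_(y <- s) f y) + \avg_(x : T) B x s ^+ 2.
    have -> : \sum_(y <- s) f y = \avg_(x : T) B x s.
      rewrite /B avg_sum; apply: eq_bigr => y _.
      by rewrite avgB avg_cst.
    transitivity (\avg_(x : T) (A s ^+ 2 + (2 * A s * B x s + B x s ^+ 2))).
      apply: eq_avg => x; rewrite /A /B /= sumrB big_const_seq iter_addr.
      rewrite count_predT size_tuple addr0 natrD natr_sum binS bin1 natrD.
      by rewrite -mulr_natr; ring.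
    by rewrite !avgD avg_cst // avgZl addrA.
  have B2 : \avg_(x : T) B x s ^+ 2 <= m%:R ^+ 2.
    apply: avg_le => // x.
    rewrite -[leLHS]real_normK ?num_real // ler_sqr ?nnegrE //.
    apply: le_trans (ler_norm_sum _ _ _) _.
    have -> : m%:R = \sum_(y <- s) 1 :> R.
      by rewrite big_const_seq iter_addr count_predT size_tuple addr0.
    by apply: ler_sum => y _; rewrite ler_norml; case: (e x y) => /=; lra.
  (* The cross term is split with weight [m + 1]: the inductive bound [m ^ 3] then grows only by
     [m ^ 3 / (m + 1)], at most [m ^ 2], and the total stays below [(m + 1) ^ 3]. *)
  have : 0 <= ((A s) - (m%:R + 1) * \sum_(y <- s) f y) ^+ 2 / (m%:R + 1).
    by rewrite divr_ge0 ?sqr_ge0 // ltW.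
  have -> : (A s - (m%:R + 1) * (\sum_(y <- s) f y)) ^+ 2 / (m%:R + 1) =
      (m%:R + 1)^-1 * A s ^+ 2 - 2 * A s * (\sum_(y <- s) f y) +
      (m%:R + 1) * (\sum_(y <- s) f y) ^+ 2.
    by field; rewrite gt_eqF.
  lra.
rewrite !avgD !avgZl avg_cst ?card_tuple_gt0 //.
have := avg_sqr_sum_le m T0 f0 f2; rewrite -natr1.
move: (avg _) IH (avg _) => V VP W WP.
have -> : (1 + (m%:R + 1)^-1) * V = V + V / (m%:R + 1) by ring.
have m0 : 0 <= m%:R :> R by rewrite ler0n.
have : V / (m%:R + 1) <= m%:R ^+ 2.
  by rewrite ler_pdivrMr //; nra.
nra.
Qed.

(** * Mismatched quadruples and edge density *)

(** The alternating sum of [e] around the 4-cycle [a], [b], [d], [c] is nonzero. *)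
Definition mismatch (T : Type) (e : rel T) (a b c d : T) : bool :=
  (e a b + e c d != e a c + e b d)%N.

Definition mismatch_prob (R : realFieldType) (T : finType) (e : rel T) : R :=
  \avg_(a : T) \avg_(b : T) \avg_(c : T) \avg_(d : T) (mismatch e a b c d)%:R.

(* If none of the first four mismatches occurs then 1, 2, 3, 4 span a complete
   graph and 5, 6, 7, 8 an empty one; the last three then force the indicators
   of 15, 26, 37 to sum to 1 in pairs. *)
Lemma mismatch_of_edges (R : realFieldType) (T : finType) (e : rel T)
    (x1 x2 x3 x4 x5 x6 x7 x8 : T) : symmetric e ->
  (e x1 x2)%:R * ((e x3 x4)%:R * ((1 - (e x5 x6)%:R) * (1 - (e x7 x8)%:R))) <=
  (mismatch e x1 x2 x3 x4)%:R + (mismatch e x1 x2 x4 x3)%:R +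
  (mismatch e x5 x6 x7 x8)%:R + (mismatch e x5 x6 x8 x7)%:R +
  (mismatch e x1 x2 x5 x6)%:R + (mismatch e x1 x3 x5 x7)%:R +
  (mismatch e x2 x3 x6 x7)%:R :> R.
Proof.
move=> e_sym.
have -> : (1 - (e x5 x6)%:R) * (1 - (e x7 x8)%:R) =
    (~~ e x5 x6 && ~~ e x7 x8)%:R :> R.
  by case: (e x5 x6); case: (e x7 x8); rewrite /=; ring.
rewrite -!natrM -!natrD ler_nat !mulnb.
have [/and4P[e12 e34 e56 e78] | //] :=
  boolP [&& e x1 x2, e x3 x4, ~~ e x5 x6 & ~~ e x7 x8].
rewrite /mismatch (e_sym x4) (e_sym x8) e12 e34.
rewrite (negPf e56) (negPf e78).
by move: (e x1 x3) (e x2 x4) (e x1 x4) (e x2 x3) (e x5 x7) (e x6 x8) (e x5 x8)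
  (e x6 x7) (e x1 x5) (e x2 x6) (e x3 x7); do !case.
Qed.

Lemma avg2_mulr (R : realFieldType) (T : finType) (F : T -> T -> R) (a : R) :
  (\avg_(x : T) \avg_(y : T) F x y) * a = \avg_(x : T) \avg_(y : T) F x y * a.
Proof. by rewrite -avgZr; apply: eq_avg => x; rewrite avgZr. Qed.

Lemma avg2_mull (R : realFieldType) (T : finType) (F : T -> T -> R) (a : R) :
  a * (\avg_(x : T) \avg_(y : T) F x y) = \avg_(x : T) \avg_(y : T) a * F x y.
Proof. by rewrite -avgZl; apply: eq_avg => x; rewrite avgZl. Qed.

Lemma ler_avg2 (R : realFieldType) (T : finType) (F G : T -> T -> R) :
  (forall x y, F x y <= G x y) ->
  \avg_(x : T) \avg_(y : T) F x y <= \avg_(x : T) \avg_(y : T) G x y.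
Proof. by move=> FG; apply: ler_avg => x; apply: ler_avg => y. Qed.

Lemma avg2D (R : realFieldType) (T : finType) (F G : T -> T -> R) :
  \avg_(x : T) \avg_(y : T) (F x y + G x y) =
  \avg_(x : T) \avg_(y : T) F x y + \avg_(x : T) \avg_(y : T) G x y.
Proof. by rewrite -avgD; apply: eq_avg => x; rewrite avgD. Qed.

(** Average [mismatch_of_edges] over eight independent vertices: the left side factors, and each of
    the seven mismatches has mean [mismatch_prob]. *)
Lemma mismatch_prob_ge (R : realFieldType) (T : finType) (e : rel T) :
  (0 < #|T|)%N -> symmetric e ->
  density R e ^+ 2 * (1 - density R e) ^+ 2 <= 7 * mismatch_prob R e.
Proof.
move=> T0 e_sym; set d := density R e; set Q := mismatch_prob R e.
pose avg4 (F : T -> T -> T -> T -> R) :=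
  \avg_(x1 : T) \avg_(x2 : T) \avg_(x3 : T) \avg_(x4 : T) F x1 x2 x3 x4.
have d' : 1 - d = \avg_(x : T) \avg_(y : T) (1 - (e x y)%:R).
  rewrite /d /density -{1}(@avg_cst R T 1 T0) -avgB.
  by apply: eq_avg => x; rewrite avgB avg_cst.
have dd : d ^+ 2 * (1 - d) ^+ 2 = avg4 (fun x1 x2 x3 x4 => avg4
    (fun x5 x6 x7 x8 =>
  (e x1 x2)%:R * ((e x3 x4)%:R * ((1 - (e x5 x6)%:R) * (1 - (e x7 x8)%:R))))).
  transitivity (d * (d * ((1 - d) * (1 - d)))); first by ring.
  rewrite {1}/d /density avg2_mulr; apply: eq_avg => x1; apply: eq_avg => x2.
  rewrite {1}/d /density avg2_mulr avg2_mull.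
  apply: eq_avg => x3; apply: eq_avg => x4.
  rewrite {1}d' avg2_mulr !avg2_mull; apply: eq_avg => x5; apply: eq_avg => x6.
  by rewrite d' !avg2_mull.
have avg4D F G : avg4 (fun a b c d => F a b c d + G a b c d) = avg4 F + avg4 G.
  rewrite /avg4 -avg2D; apply: eq_avg => a; apply: eq_avg => b.
  by rewrite -avg2D.
have ler_avg4 F G :
    (forall a b c d, F a b c d <= G a b c d) -> avg4 F <= avg4 G.
  by move=> FG; do 2!apply: ler_avg2 => ? ?.
have -> : 7 * Q = Q + Q + Q + Q + Q + Q + Q by ring.
have avg8D F G : avg4 (fun x1 x2 x3 x4 => avg4 (fun x5 x6 x7 x8 =>
     F x1 x2 x3 x4 x5 x6 x7 x8 + G x1 x2 x3 x4 x5 x6 x7 x8)) =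
     avg4 (fun x1 x2 x3 x4 => avg4 (F x1 x2 x3 x4)) +
     avg4 (fun x1 x2 x3 x4 => avg4 (G x1 x2 x3 x4)).
  by rewrite -avg4D; do 4!apply: eq_avg => ?; rewrite avg4D.
rewrite dd.
apply: le_trans (ler_avg4 _ _ (fun x1 x2 x3 x4 =>
  ler_avg4 _ _ (fun x5 x6 x7 x8 =>
    mismatch_of_edges R x1 x2 x3 x4 x5 x6 x7 x8 e_sym))) _.
rewrite !avg8D le_eqVlt; apply/orP; left; apply/eqP; rewrite /avg4.
do 6?[congr (_ + _)].
- by do ![rewrite avg_cst // | apply: eq_avg => ?].
- do 2!apply: eq_avg => ?; rewrite exchange_avg.
  by do ![rewrite avg_cst // | apply: eq_avg => ?].
- by do ![rewrite avg_cst // | apply: eq_avg => ?].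
- do 4!rewrite avg_cst //; do 2!apply: eq_avg => ?; rewrite exchange_avg.
  by do ![rewrite avg_cst // | apply: eq_avg => ?].
- by do ![rewrite avg_cst // | apply: eq_avg => ?].
- by do ![rewrite avg_cst // | apply: eq_avg => ?].
- by do ![rewrite avg_cst // | apply: eq_avg => ?].
Qed.

(** * Decoupling *)

(** Cauchy-Schwarz over [u] duplicates [s]; Cauchy-Schwarz over the pair [s], [s'] then duplicates
    [u]. *)
Lemma decoupling (R : realFieldType) (S U : finType) (F : S -> U -> R) :
  (0 < #|S|)%N -> (0 < #|U|)%N ->
  (\avg_(s : S) \avg_(u : U) F s u) ^+ 4 <=
  \avg_(s : S) \avg_(s' : S) \avg_(u : U) \avg_(u' : U)
    (F s u * F s' u * (F s u' * F s' u')).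
Proof.
move=> S0 U0; rewrite exchange_avg (exprM _ 2 2).
pose G s s' := \avg_(u : U) (F s u * F s' u).
apply: (@le_trans _ _ ((\avg_(s : S) \avg_(s' : S) G s s') ^+ 2)).
  rewrite ler_sqr ?nnegrE ?sqr_ge0 //; last first.
    rewrite /G; under eq_avg => s do rewrite exchange_avg.
    rewrite exchange_avg; apply: avg_ge0 => u.
    by rewrite -avg_mul -expr2 sqr_ge0.
  apply: le_trans (sqr_avg_le _ U0) _; rewrite le_eqVlt; apply/orP; left.
  apply/eqP; rewrite /G; under [RHS]eq_avg => s do rewrite exchange_avg.
  by rewrite [RHS]exchange_avg; apply: eq_avg => u; rewrite expr2 avg_mul.
apply: le_trans (sqr_avg_le _ S0) _; apply: ler_avg => s.
apply: le_trans (sqr_avg_le _ S0) _; apply: ler_avg => s'.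
by rewrite expr2 /G avg_mul.
Qed.

Lemma exchange_avg2 (R : realFieldType) (S T : finType)
    (F : S -> S -> T -> T -> R) :
  \avg_(s : S) \avg_(s' : S) \avg_(x : T) \avg_(y : T) F s s' x y =
  \avg_(x : T) \avg_(y : T) \avg_(s : S) \avg_(s' : S) F s s' x y.
Proof.
under eq_avg => s do rewrite exchange_avg.
rewrite exchange_avg; apply: eq_avg => x.
under eq_avg => s do rewrite exchange_avg.
by rewrite exchange_avg.
Qed.

Lemma diff_law_mean_le (R : realFieldType) (T : finType) (e : rel T)
    (a b L : nat) (p : R) :
  (0 < #|T|)%N -> (0 < a)%N -> (0 < b)%N -> (0 < L)%N ->
  symmetric e -> 0 < p <= mismatch_prob R e ->
  \avg_(s : a.-tuple T) \avg_(s' : a.-tuple T) diff_law R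
    (fun z => \sum_(y <- s) (e y z)%:Z - \sum_(y <- s') (e y z)%:Z) b 0 <=
  L%:R^-1 + 4 * L%:R / (p * b%:R) + 4 / p * (L%:R^-1 + 2 * L%:R / (p * a%:R)).
Proof.
move=> T0 a0 b0 L0 e_sym /andP[p0 pP].
have aR : 0 < a%:R :> R by rewrite ltr0n.
have bR : 0 < b%:R :> R by rewrite ltr0n.
have LR : 0 < L%:R :> R by rewrite ltr0n.
pose g (z z' y : T) := (e y z)%:Z - (e y z')%:Z.
pose h (s s' : seq T) z := \sum_(y <- s) (e y z)%:Z - \sum_(y <- s') (e y z)%:Z.
pose q z z' := diff_prob R (g z z').
have qE : \avg_(z : T) \avg_(z' : T) q z z' = mismatch_prob R e.
  apply: eq_avg => z; rewrite /q /diff_prob.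
  under [RHS]eq_avg => y do rewrite exchange_avg.
  rewrite [RHS]exchange_avg.
  do 3!apply: eq_avg => ?; rewrite /mismatch /g !(e_sym z).
  by do 4!case: (e _ _).
(* If h s s' rarely separates two vertices, it fails to separate a positive
   proportion of the good pairs; by Littlewood-Offord over s, s' every good
   pair is separated with probability close to 1, so this is rare. *)
pose good z z' := p / 2 <= q z z'.
pose bad s s' := \avg_(z : T) \avg_(z' : T)
   ((good z z')%:R * (h s s' z == h s s' z')%:R : R).
have avg_bad : \avg_(s : a.-tuple T) \avg_(s' : a.-tuple T) bad s s' <=
    L%:R^-1 + 2 * L%:R / (p * a%:R).
  rewrite exchange_avg2; apply: avg_le => // z; apply: avg_le => // z'.
  have -> : \avg_(s : a.-tuple T) \avg_(s' : a.-tuple T)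
        ((good z z')%:R * (h s s' z == h s s' z')%:R) =
      (good z z')%:R * diff_law R (g z z') a 0.
    rewrite avg2_mull; apply: eq_avg => s; apply: eq_avg => s'.
    rewrite -subr_eq0 /h /g !sumrB; congr (_ * (_ == _)%:R); ring.
  have rhs0 : 0 <= L%:R^-1 + 2 * L%:R / (p * a%:R).
    by rewrite addr_ge0 ?invr_ge0 ?divr_ge0 ?mulr_ge0 ?(ltW p0) // ltW.
  rewrite /good; case: (leP (p / 2)) => [qp|_]; last by rewrite mul0r.
  have q0 : 0 < q z z' by apply: lt_le_trans qp; lra.
  rewrite mul1r; apply: le_trans (diff_law_le 0 T0 q0 L0 a0) _.
  rewrite lerD2l.
  have -> : 2 * L%:R / (p * a%:R) = L%:R / (p / 2 * a%:R).
    by field; rewrite !gt_eqF.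
  rewrite ler_pM2l // lef_pV2 ?posrE ?(mulr_gt0 q0 aR) ?ler_pM2r //.
  by rewrite mulr_gt0 // divr_gt0.
(* A pointwise bound: the first two terms handle [diff_prob] at least [p / 4]; otherwise [bad] is at
   least [p / 4] and the last term alone reaches 1. *)
apply: (@le_trans _ _ (\avg_(s : a.-tuple T) \avg_(s' : a.-tuple T)
   (L%:R^-1 + 4 * L%:R / (p * b%:R) + 4 / p * bad s s'))); last first.
  have Ta := card_tuple_gt0 a T0.
  rewrite [leLHS]avg2D avg_cst // avg_cst // lerD2l -avg2_mull.
  by rewrite ler_wpM2l // divr_ge0 // ltW.
apply: ler_avg2 => s s'; rewrite -/(h s s').
have bad0 : 0 <= bad s s'.
  by apply: avg_ge0 => z; apply: avg_ge0 => z'; rewrite mulr_ge0 ?ler0n.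
have [pdiff|pdiff] := leP (p / 4) (diff_prob R (h s s')).
  have h0 : 0 < diff_prob R (h s s') by apply: lt_le_trans pdiff; lra.
  apply: le_trans (diff_law_le 0 T0 h0 L0 b0) _; rewrite -[leLHS]addr0 lerD //.
    rewrite lerD2l.
    have -> : 4 * L%:R / (p * b%:R) = L%:R / (p / 4 * b%:R).
      by field; rewrite !gt_eqF.
    rewrite ler_pM2l // lef_pV2 ?posrE ?(mulr_gt0 h0 bR) ?ler_pM2r //.
    by rewrite mulr_gt0 // divr_gt0.
  by rewrite mulr_ge0 // divr_ge0 // ltW.
have law1 : diff_law R (h s s') b 0 <= 1.
  have := @diff_law_sum_le1 R T (h s s') b [:: 0] T0 isT.
  by rewrite big_seq1.
(* Reverse Markov: [q] has mean at least [p] and is at most 1 on good pairs, below [p / 2]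
   elsewhere. *)
have goodP : p / 2 <= \avg_(z : T) \avg_(z' : T) ((good z z')%:R : R).
  have : \avg_(z : T) \avg_(z' : T) q z z' <=
      \avg_(z : T) \avg_(z' : T) ((good z z')%:R + p / 2).
    apply: ler_avg2 => z z'; rewrite /good.
    case: (leP (p / 2)) => [_|/ltW]; last by rewrite add0r.
    rewrite -[leLHS]addr0 lerD ?divr_ge0 ?(ltW p0) //.
    by apply: avg_le => // y; apply: avg_le => // y'; rewrite lern1 leq_b1.
  rewrite qE avg2D [X in _ <= _ + X -> _]avg_cst // avg_cst //; lra.
have : \avg_(z : T) \avg_(z' : T) ((good z z')%:R : R) <=
   bad s s' + diff_prob R (h s s').
  rewrite -avg2D; apply: ler_avg2 => z z'.
  by case: (good z z'); case: eqP => _ /=; rewrite -?natrM -?natrD ?ler_nat.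
move=> gbd.
have badp : p / 4 <= bad s s' by lra.
have : 1 <= 4 / p * bad s s'.
  by rewrite mulrAC ler_pdivlMr // mul1r; lra.
have : 0 <= L%:R^-1 + 4 * L%:R / (p * b%:R).
  by rewrite addr_ge0 ?invr_ge0 ?divr_ge0 ?mulr_ge0 ?(ltW p0) // ltW.
lra.
Qed.

(** When all four combinations of [s], [s'] with [t], [t'] span [l] edges, the alternating sum
    cancels the edges inside each part. Only the cross edges remain, and these form the event of
    [diff_law_mean_le]. *)
Lemma edges_in_prob_le (R : realFieldType) (T : finType) (e : rel T)
    (a b L l : nat) (p : R) :
  (0 < #|T|)%N -> (0 < a)%N -> (0 < b)%N -> (0 < L)%N ->
  symmetric e -> 0 < p <= mismatch_prob R e ->
  (\avg_(s : (a + b).-tuple T) ((edges_in e s == l)%:R : R)) ^+ 4 <=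
  L%:R^-1 + 4 * L%:R / (p * b%:R) + 4 / p * (L%:R^-1 + 2 * L%:R / (p * a%:R)).
Proof.
move=> T0 a0 b0 L0 e_sym p0.
apply: le_trans (diff_law_mean_le T0 a0 b0 L0 e_sym p0).
rewrite (avg_tuple_cat a b (fun s => (edges_in e s == l)%:R)).
apply: le_trans (decoupling _ _ _) _; rewrite ?card_tuple_gt0 //.
apply: ler_avg2 => s s'; apply: ler_avg2 => t t'.
rewrite -!natrM ler_nat !mulnb.
case: andP => [[/andP[/eqP E1 /eqP E2] /andP[/eqP E3 /eqP E4]]|//].
have crossE u v : \sum_(z <- v) \sum_(y <- u) (e y z)%:Z =
    (\sum_(x <- u) \sum_(y <- v) e x y)%N%:Z.
  rewrite exchange_big (big_morph Posz PoszD (erefl _)) /=.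
  by apply: eq_bigr => x _; rewrite (big_morph Posz PoszD (erefl _)).
rewrite !sumrB !crossE; apply/eqP.
move: E1 E2 E3 E4; rewrite !edges_in_cat; lia.
Qed.

(** * From sequences to subsets *)

(** Induction on [s]: edges through the new vertex [x] correspond to its neighbours in [s], and the
    remaining edges lie within [s]. *)
Lemma induced_edges_seq (T : finType) (E : {set {set T}}) (s : seq T) :
  simple_graph E -> uniq s ->
  induced_edges E [set x in s] = edges_in (fun x y => [set x; y] \in E) s.
Proof.
move=> /forall_inP E2; elim: s => [|x s IH] /=.
  move=> _; apply/eqP; rewrite cards_eq0; apply/eqP/setP => A; rewrite !inE.
  apply/negP => /andP[/E2 /eqP A2] /subset_leq_card; rewrite A2 leqNgt.
  by rewrite (_ : #|_| = 0%N) //; apply: eq_card0 => x; rewrite inE.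
case/andP=> xs us; rewrite -IH // /induced_edges set_cons.
rewrite -(cardsID [set A : {set T} | x \in A]); congr (_ + _)%N; last first.
  have -> : [set y in s] = (x |: [set y in s]) :\ x by rewrite setU1K // inE.
  apply: eq_card => A; rewrite !inE subsetD1 setU1K ?inE //.
  by rewrite andbC -andbA.
pose S := [set y in s | [set x; y] \in E].
have -> : (\sum_(y <- s) ([set x; y] \in E) = #|S|)%N.
  transitivity (count (fun y => [set x; y] \in E) s).
    by rewrite -sum1_count [RHS]big_mkcond.
  rewrite -size_filter -(card_uniqP (filter_uniq _ us)); apply: eq_card => y.
  by rewrite inE mem_filter andbC.
rewrite -(@card_in_imset _ _ (fun y => [set x; y]) (mem S)); last first.
  move=> y z; rewrite !inE => /andP[ys _] _ /setP/(_ y).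
  rewrite !inE eqxx orbT eq_sym => /esym/orP[/eqP xy|/eqP //].
  by rewrite xy ys in xs.
apply: eq_card => A; rewrite !inE; apply/andP/imsetP => [[/andP[AE AS] xA]|[y]].
  have /cards2P[y [z [yz Ayz]]] := E2 A AE.
  have {}xA : (x == y) || (x == z) by move: xA; rewrite Ayz !inE.
  have {y z yz Ayz xA} [z [zx Axz]] : exists z, z != x /\ A = [set x; z].
    case/orP: xA => /eqP xE; first by exists z; rewrite xE eq_sym.
    by exists y; rewrite xE finset.setUC.
  exists z => //; rewrite !inE -Axz AE andbT.
  have /(fintype.subsetP AS) : z \in A by rewrite Axz !inE eqxx orbT.
  by rewrite !inE (negPf zx).
rewrite inE => /andP[ys xyE] ->; rewrite xyE !inE eqxx /=; split=> //.
apply/fintype.subsetP => z; rewrite !inE => /orP[->//|/eqP ->].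
by rewrite ys orbT.
Qed.

(** A birthday bound with denominators cleared: at most a fraction [k ^ 2 / n] of the [k]-tuples has
    a repeated entry. *)
Lemma expn_le_ffact (n k : nat) :
  (k <= n)%N -> (n * n ^ k <= n * n ^_ k + k ^ 2 * n ^ k)%N.
Proof.
elim: k => [|k IH] kn; first by rewrite addn0.
have [d dk] : exists d, n = (d + k)%N.
  by exists (n - k)%N; rewrite subnK // ltnW.
rewrite ffactnSr expnS (_ : n - k = d)%N; last by rewrite dk addnK.
have := leq_mul (leqnn d) (IH (ltnW kn)).
set a := expn n k; set f := falling_factorial n k => IHd.
have : (k * (d + k) * a + d * k ^ 2 * a <= k.+1 ^ 2 * ((d + k) * a))%N.
  have := leq_mul (leqnn (k ^ 2 * a)) (leq_addr k d).
  have : (k ^ 2 + k <= k.+1 ^ 2)%N by lia.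
  move/(leq_mul (leqnn ((d + k) * a))%N); lia.
move: a f IHd; rewrite dk => a f; lia.
Qed.

(** Each [k]-subset arises from [k!] repetition-free tuples, and these make up at least half of all
    tuples; hence the factor 2. *)
Lemma edge_count_prob_le (R : realType) (T : finType) (E : {set {set T}})
    (k l : nat) :
  simple_graph E -> (0 < k)%N -> (2 * k ^ 2 <= #|T|)%N ->
  edge_count_prob R E k l <= 2 * \avg_(s : k.-tuple T)
    (edges_in (fun x y => [set x; y] \in E) s == l)%:R.
Proof.
move=> E2 k0 kT; set n := #|T| in kT *.
pose e : rel T := fun x y => [set x; y] \in E; rewrite -/e.
have kn : (k <= n)%N by apply: leq_trans kT; nia.
have n0 : (0 < n)%N by apply: leq_trans kn.
pose N := #|[set A in ksubsets T k | induced_edges E A == l]|.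
have NM : (N * k`! <= \sum_(s : k.-tuple T) (edges_in e s == l))%N.
  apply: (@leq_trans (\sum_(s : k.-tuple T | uniq s &&
     ([set x in s] \in [set A in ksubsets T k | induced_edges E A == l])) 1)%N).
    rewrite (partition_big (fun s : k.-tuple T => [set x in s])
      (mem [set A in ksubsets T k | induced_edges E A == l])) /=; last first.
      by move=> s /andP[].
    rewrite -sum_nat_const; apply: leq_sum => A AP.
    have cA : #|A| = k by move: AP; rewrite !inE => /andP[/eqP].
    rewrite -[k in k`!]cA -ffactnn {2}cA -(card_uniq_tuples k (mem A)).
    rewrite sum1dep_card; apply: subset_leq_card.
    apply/fintype.subsetP => s; rewrite !inE => /andP[/allP sA us].
    have sE : [set x in s] = A.
      apply/eqP; rewrite eqEcard; apply/andP; split.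
        by apply/fintype.subsetP => x; rewrite inE; exact: sA.
      by rewrite cA cardsE (card_uniqP us) size_tuple.
    by rewrite us sE eqxx andbT; move: AP; rewrite !inE.
  rewrite big_mkcond /=; apply: leq_sum => s _.
  case: ifP => // /andP[us]; rewrite !inE => /andP[_ /eqP].
  by rewrite induced_edges_seq // => ->; rewrite eqxx.
rewrite /edge_count_prob -/N /ksubsets card_draws -/n.
have binR : 'C(n, k)%:R * k`!%:R = (n ^_ k)%:R :> R by rewrite -natrM bin_ffact.
have b0 : 0 < 'C(n, k)%:R :> R by rewrite ltr0n bin_gt0.
have f0 : 0 < k`!%:R :> R by rewrite ltr0n fact_gt0.
have half : (n ^ k <= 2 * n ^_ k)%N.
  have := expn_le_ffact kn; have := leq_mul kT (leqnn (n ^ k)%N).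
  rewrite -(@leq_pmul2l n) //.
  by move: (expn n k) (falling_factorial n k) (k ^ 2)%N => a f q; nia.
rewrite /avg card_tuple -/n -natr_sum mulrA ler_pdivlMr ?ltr0n ?expn_gt0 ?n0 //.
rewrite mulrAC ler_pdivrMr // -(ler_pM2r f0) -[leRHS]mulrA binR.
rewrite -!natrM ler_nat.
set S := (\sum_(s : _) _)%N in NM *.
nia.
Qed.

(** * The polynomial bound *)

Lemma bin2_double (k : nat) : ('C(k, 2) * 2 + k = k * k)%N.
Proof. by elim: k => // k; rewrite binS bin1; lia. Qed.

Lemma edges_in_chebyshev (R : realFieldType) (T : finType) (e : rel T)
    (k l : nat) (D : R) :
  (0 < #|T|)%N -> 0 <= D -> D <= `|l%:R - 'C(k, 2)%:R * density R e| ->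
  (\avg_(s : k.-tuple T) (edges_in e s == l)%:R) * D ^+ 2 <= k%:R ^+ 3.
Proof.
move=> T0 D0 Dl; apply: le_trans (edges_in_variance R e k T0).
rewrite -avgZr; apply: ler_avg => s; case: eqP => [->|_]; last first.
  by rewrite mul0r sqr_ge0.
by rewrite mul1r -[leRHS]real_normK ?num_real // ler_sqr ?nnegrE.
Qed.

Lemma edges_in_prob_dense (R : realFieldType) (T : finType) (e : rel T)
    (k l : nat) (p : R) :
  (0 < #|T|)%N -> symmetric e -> (2 <= k)%N ->
  0 < p <= 1 -> p <= mismatch_prob R e ->
  (\avg_(s : k.-tuple T) ((edges_in e s == l)%:R : R)) ^+ 8 <=
  4 * (41 / p ^+ 2) ^+ 2 / k%:R.
Proof.
move=> T0 e_sym k2 /andP[p0 p1] pP.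
set q := avg _.
have kR : 2 <= k%:R :> R by rewrite (ler_nat R 2).
pose a := k./2; pose b := (k - a)%N.
have [kab [a0 b0] [ka kb]] : [/\ k = (a + b)%N, (0 < a)%N /\ (0 < b)%N &
    (k <= 3 * a)%N /\ (k <= 3 * b)%N].
  by rewrite /a /b; split; [|split|split]; lia.
(* [L] is the integer square root of [k], which balances [1 / L] against [L / k]. *)
have [L [L0 Lk kL]] : exists L : nat,
    [/\ (0 < L)%N, (L ^ 2 <= k)%N & (k < L.+1 ^ 2)%N].
  have ex : exists L, (L ^ 2 <= k)%N by exists 0%N.
  have ub L : (L ^ 2 <= k)%N -> (L <= k)%N by nia.
  case: (ex_maxnP ex ub) => L Lk Lmax; exists L; split => //.
    by apply: Lmax; lia.
  by rewrite ltnNge; apply/negP => /Lmax; rewrite ltnn.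
have LR : 1 <= L%:R :> R by rewrite (ler_nat R 1).
have LkR : L%:R ^+ 2 <= k%:R :> R by rewrite -natrX ler_nat.
have kLR : k%:R <= 4 * L%:R ^+ 2 :> R by rewrite -natrX -natrM ler_nat; nia.
have LM m : (k <= 3 * m)%N -> (0 < m)%N -> L%:R / (p * m%:R) <= 3 / (p * L%:R).
  move=> km m0; have mR : 0 < m%:R :> R by rewrite ltr0n.
  have kmR : k%:R <= 3 * m%:R :> R by rewrite -natrM ler_nat.
  rewrite ler_pdivrMr ?mulr_gt0 //.
  have -> : 3 / (p * L%:R) * (p * m%:R) = 3 * m%:R / L%:R.
    by field; rewrite !gt_eqF //; lra.
  by rewrite ler_pdivlMr; lra.
have LA := LM a ka a0; have LB := LM b kb b0.
have q4 : q ^+ 4 <= 41 / p ^+ 2 / L%:R.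
  have p0P : 0 < p <= mismatch_prob R e by rewrite p0.
  have := @edges_in_prob_le R T e a b L l p T0 a0 b0 L0 e_sym p0P.
  rewrite -kab -/q => /le_trans; apply.
  have ->: 4 * L%:R / (p * b%:R) = 4 * (L%:R / (p * b%:R)) by rewrite mulrA.
  have ->: 2 * L%:R / (p * a%:R) = 2 * (L%:R / (p * a%:R)) by rewrite mulrA.
  apply: (@le_trans _ _ (L%:R^-1 + 4 * (3 / (p * L%:R)) +
     4 / p * (L%:R^-1 + 2 * (3 / (p * L%:R))))).
    apply: lerD.
      by rewrite lerD2l ler_pM2l // LB.
    by rewrite ler_pM2l ?divr_gt0 // lerD2l ler_pM2l // LA.
  (* Since [p <= 1], the numerator is at most 1 + 16 + 24 = 41. *)
  have -> : L%:R^-1 + 4 * (3 / (p * L%:R)) +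
      4 / p * (L%:R^-1 + 2 * (3 / (p * L%:R))) =
      (p ^+ 2 + 16 * p + 24) / p ^+ 2 / L%:R.
    by field; rewrite !gt_eqF //; lra.
  rewrite ler_pM2r ?invr_gt0; last by lra.
  by rewrite ler_pM2r ?invr_gt0 ?exprn_gt0 //; nra.
have q0 : 0 <= q by apply: avg_ge0 => s; exact: ler0n.
rewrite (exprM q 4 2).
apply: (@le_trans _ _ ((41 / p ^+ 2 / L%:R) ^+ 2)).
  by rewrite ler_sqr ?nnegrE ?exprn_ge0 // (le_trans _ q4) ?exprn_ge0.
rewrite exprMn; move: (_ ^+ 2) (sqr_ge0 (41 / p ^+ 2)) => v v0.
rewrite [4 * v]mulrC -mulrA ler_wpM2l // exprVn.
have L2 : 0 < L%:R ^+ 2 :> R by rewrite exprn_gt0 //; lra.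
by rewrite ler_pdivlMr ?[_^-1 * _]mulrC ?ler_pdivrMr //; lra.
Qed.

(** The three summands match three cases: [k] small, where the bound exceeds 1; [l] far from the
    mean, by Chebyshev; and density away from 0 and 1. As [q] lies in [0, 1], bounds on [q] or
    [q ^+ 8] pass to [q ^+ 10]. *)
Lemma edges_in_prob_pow (R : realFieldType) (c : R) (T : finType) (e : rel T)
    (k l : nat) :
  0 < c -> (0 < #|T|)%N -> symmetric e -> (0 < k)%N ->
  c * k%:R ^+ 2 <= l%:R -> c * k%:R ^+ 2 <= k%:R ^+ 2 / 2 - l%:R ->
  (\avg_(s : k.-tuple T) ((edges_in e s == l)%:R : R)) ^+ 10 <=
  (2 / c + 4 / c ^+ 2 + 4 * (41 / (c ^+ 4 / 28) ^+ 2) ^+ 2) / k%:R.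
Proof.
move=> c0 T0 e_sym k0 cl cl'; set q := avg _; set p := c ^+ 4 / 28.
have kR : 1 <= k%:R :> R by rewrite (ler_nat R 1).
have kR0 : 0 < k%:R :> R by lra.
have c14 : c <= 1 / 4.
  have k20 : 0 < k%:R ^+ 2 :> R by rewrite exprn_gt0.
  by rewrite -(ler_pM2r k20); lra.
have p0 : 0 < p by rewrite divr_gt0 ?exprn_gt0.
have q01 : 0 <= q <= 1.
  rewrite avg_ge0 => [|s]; last exact: ler0n.
  by apply: avg_le => [|s]; rewrite ?card_tuple_gt0 // lern1 leq_b1.
have M1 : 0 < 2 / c by rewrite divr_gt0.
have M2 : 0 < 4 / c ^+ 2 by rewrite divr_gt0 ?exprn_gt0.
have M3 : 0 < 4 * (41 / p ^+ 2) ^+ 2.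
  by rewrite mulr_gt0 // exprn_gt0 // divr_gt0 // exprn_gt0.
rewrite !mulrDl.
have N1 : 0 < 2 / c / k%:R by rewrite divr_gt0.
have N2 : 0 < 4 / c ^+ 2 / k%:R by rewrite divr_gt0.
have N3 : 0 < 4 * (41 / p ^+ 2) ^+ 2 / k%:R by rewrite divr_gt0.
have qle n : (0 < n <= 10)%N -> q ^+ 10 <= q ^+ n.
  by case/andP: q01 => q0 q1 /andP[_]; exact: ler_wiXn2l.
have [ck|ck] := leP (c * k%:R) 2.
  have : 1 <= 2 / c / k%:R.
    by rewrite -mulrA -invfM ler_pdivlMr ?mulr_gt0 // mul1r.
  have := qle 1%N isT; rewrite expr1; lra.
set d := density R e.
have [far|near] := leP (c * k%:R ^+ 2 / 2) `|l%:R - 'C(k, 2)%:R * d|.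
  have D0 : 0 < c * k%:R ^+ 2 / 2 by rewrite divr_gt0 ?mulr_gt0 ?exprn_gt0.
  have := edges_in_chebyshev T0 (ltW D0) far; rewrite -/q => qD.
  have : q <= 4 / c ^+ 2 / k%:R.
    rewrite -(ler_pM2r (exprn_gt0 2 D0)); apply: le_trans qD _.
    by rewrite le_eqVlt; apply/orP; left; apply/eqP; field; rewrite !gt_eqF.
  have := qle 1%N isT; rewrite expr1; lra.
have k2 : (2 <= k)%N.
  rewrite ltnNge; apply/negP => k1.
  have : k%:R <= 1 :> R by rewrite (ler_nat R k 1).
  nra.
have binE : 'C(k, 2)%:R = k%:R * (k%:R - 1) / 2 :> R.
  have /(congr1 (fun i => i%:R : R)) := bin2_double k.
  by rewrite natrD !natrM; lra.
have /andP[d0 d1] : 0 <= d <= 1.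
  rewrite avg_ge0 => [|x]; last by apply: avg_ge0 => y; exact: ler0n.
  by apply: avg_le => // x; apply: avg_le => // y; rewrite lern1 leq_b1.
move: near; rewrite binE ltr_norml => /andP[near1 near2].
have k20 : 0 < k%:R ^+ 2 / 2 :> R by rewrite divr_gt0 ?exprn_gt0.
have dc : c <= d by rewrite -(ler_pM2r k20); nra.
(* Replacing [k ^ 2 / 2] by ['C(k, 2)] costs [k / 2], at most [c k ^ 2 / 4] because [c k > 2]; hence
   [c / 2] here and the 28 in [p], as [c ^ 2 (c / 2) ^ 2 = 7 p]. *)
have dc' : c / 2 <= 1 - d by rewrite -(ler_pM2r k20); nra.
have pP : p <= mismatch_prob R e.
  have := mismatch_prob_ge R T0 e_sym; rewrite -/d.
  have : c ^+ 2 * (c / 2) ^+ 2 <= d ^+ 2 * (1 - d) ^+ 2.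
    have c2 : 0 <= c / 2 by rewrite divr_ge0 // ltW.
    by rewrite ler_pM ?sqr_ge0 // ler_sqr ?nnegrE ?subr_ge0 // ltW.
  have -> : c ^+ 2 * (c / 2) ^+ 2 = 7 * p by rewrite /p; field.
  lra.
have p1 : p <= 1.
  have : c ^+ 4 <= 1 by rewrite exprn_ile1 // ?ltW //; lra.
  by rewrite /p; lra.
have := qle 8%N isT.
have := @edges_in_prob_dense R T e k l p T0 e_sym k2; rewrite p0 => /(_ p1 pP).
rewrite -/q; lra.
Qed.

Theorem theorem1p5 (R : realType) (c : R) (hc : 0 < c) :
  exists K : R, 0 < K /\
    forall k l : nat, (0 < k)%N -> (0 < l)%N -> (l <= 'C(k, 2))%N ->
      c * k%:R ^+ 2 <= Num.min l%:R (k%:R ^+ 2 / 2 - l%:R) ->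
      edge_inducibility R k l <= K * k%:R `^ (- (1 / 10)).
Proof.
set M := 2 / c + 4 / c ^+ 2 + 4 * (41 / (c ^+ 4 / 28) ^+ 2) ^+ 2.
have M0 : 0 < M.
  by rewrite !addr_gt0 ?mulr_gt0 ?invr_gt0 ?exprn_gt0 ?mulr_gt0 ?invr_gt0
    ?exprn_gt0.
(* The 2 is the cost of passing from subsets to tuples; the tenth root undoes the power in
   [edges_in_prob_pow]. *)
exists (2 * M `^ (1 / 10)); split; first by rewrite mulr_gt0 ?powR_gt0.
move=> k l k0 _ _; rewrite le_min => /andP[cl cl'].
have kR : 0 < k%:R :> R by rewrite ltr0n.
set K := _ * _.
have K0 : 0 <= K by rewrite !mulr_ge0 ?powR_ge0.
rewrite /edge_inducibility.
(* If the limit did not exist, [limn] would return the default value 0. *)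
have [cvgI|/dvgP -> //] :=
  pselect (cvg (max_edge_prob R n k l @[n --> \oo])%classic).
apply: limr_le => //; exists (2 * k ^ 2)%N => // n /= kn.
apply: bigmax_le => // E E2.
have T0 : (0 < #|'I_n|)%N by rewrite card_ord; nia.
apply: le_trans (edge_count_prob_le R l E2 k0 _) _; first by rewrite card_ord.
set e : rel 'I_n := fun x y => [set x; y] \in E.
have e_sym : symmetric e by move=> x y; rewrite /e finset.setUC.
have := edges_in_prob_pow hc T0 e_sym k0 cl cl'.
have : 0 <= \avg_(s : k.-tuple 'I_n) ((edges_in e s == l)%:R : R).
  by apply: avg_ge0 => s; exact: ler0n.
rewrite -/M /K -/e; move: (avg _) => q q0 qM.
rewrite -mulrA ler_pM2l //.
have -> : q = (q ^+ 10) `^ (1 / 10).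
  by rewrite -powR_mulrn // -powRrM mul1r divff ?powRr1.
have -> : k%:R `^ (- (1 / 10)) = (k%:R^-1) `^ (1 / 10) :> R.
  by rewrite -(powR_inv1 (ltW kR)) -powRrM mulN1r.
rewrite -powRM ?invr_ge0 ?(ltW M0) // ge0_ler_powR ?nnegrE //.
- exact: exprn_ge0.
- by rewrite divr_ge0 // ltW.
Qed.
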